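(* Let $N_*=(N_{k,i})_{k\ge1,\,i\in\{1,2,3\}}$ be a sequence of positive integers. Let $\rho\in\,]0,1[$, $\ell\geq 1$, $j\in\{0,\cdots,7\Omega_{\ell}-1\}$. Then $$\mathrm{d}_{Hauss}\left(\mathbf{n}^{\Phi}_{\infty}(\Gamma^j_{\ell}),\ \mathrm{rot}_{\ell}^j \circ \mathbf{n}^{\Phi}_{\infty}(\Gamma_{\ell}^0)\right)\leq \frac{4\pi\, \mathrm{Lip}_\rho(\mathbf{F}_{\ell-1}^{\Phi})}{7\Omega_{\ell}}.$$ In particular, with $\Gamma=\{(\rho,\varphi):\varphi\in\mathbb{R}/2\pi\mathbb{Z}\}$, $$\mathrm{d}_{Hauss}\left(\mathbf{n}^{\Phi}_{\infty}(\Gamma),\ \bigcup_{j=0}^{7\Omega_{\ell}-1}\mathrm{rot}_{\ell}^j \circ \mathbf{n}^{\Phi}_{\infty}(\Gamma_{\ell}^0)\right)\leq \frac{4\pi\, \mathrm{Lip}_\rho(\mathbf{F}_{\ell-1}^{\Phi})}{7\Omega_{\ell}}.$$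
   Context: Points are given in polar coordinates $(\rho,\varphi)$, $0<\rho<1$, $\varphi\in\mathbb{R}/2\pi\mathbb{Z}$; tangent spaces are identified with $\mathbb{R}^2$ by the direct basis $(\partial_\rho,\partial_\varphi)$. $\wedge$ is the cross product in $\mathbb{E}^3$; $\Psi^*\langle\cdot,\cdot\rangle(v,w)=\langle\Psi v,\Psi w\rangle$. $J_0$ is the Bessel function of the first kind of order 0, $\kappa_0$ its first positive zero, $J_0^{-1}:\,]0,1]\to[0,\kappa_0[$ the inverse of $J_0|_{[0,\kappa_0[}$. $\mathrm d_{Hauss}$ is the Hausdorff distance between subsets of $\mathbb{E}^3$. Data. $a=\frac{7}{2\pi}$; $\varpi_1=-\rho$, $\varpi_2=\rho-a\varphi$, $\varpi_3=\rho+a\varphi$; $\ell_i=d\varpi_i$; for $B=E\,d\rho^2+F(d\rho\otimes d\varphi+d\varphi\otimes d\rho)+G\,d\varphi^2$, $H_1(B)=E-\frac{G}{a^2}$, $H_2(B)=\frac{G}{2a^2}-\frac{F}{2a}$, $H_3(B)=\frac{G}{2a^2}+\frac{F}{2a}$ (so $B=\sum_iH_i(B)\ell_i\otimes\ell_i$). $f_0(\rho,\varphi)=2(\rho\cos\varphi,\rho\sin\varphi,\frac{\sqrt2}{2}\rho^2)$, and $g_k=f_0^*\langle\cdot,\cdot\rangle+4\sum_{n=1}^k(n+2)\rho^{2(n+1)}d\rho^2+4\sum_{n=1}^k(n+1)\rho^{2(n+1)}d\varphi^2$. Frame of $(\Psi,\lambda)$. For an injective linear map $\Psi:\mathbb{R}^2\to\mathbb{E}^3$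 and a nonzero linear form $\lambda$, let $(v,w)$ be a direct basis of $\mathbb{R}^2$ with $\lambda(v)>0$, $w\in\ker\lambda$; the frame is $(\mathbf t,\mathbf w,\mathbf n)$ with $\mathbf w=\frac{\Psi(w)}{\|\Psi(w)\|}$, $\mathbf n=\frac{\Psi(v)\wedge\Psi(w)}{\|\Psi(v)\wedge\Psi(w)\|}$, $\mathbf t=\mathbf w\wedge\mathbf n$. Formal corrugation process. For $\eta\ge0$ and an integer $N\ge1$, pointwise $FCP(\Phi,\eta,\varpi,N)=\Phi+\big(r(\cos\theta\,\mathbf t+\sin\theta\,\mathbf n)-\Phi(u)\big)\otimes d\varpi$, where $(\mathbf t,\mathbf w,\mathbf n)$ is the frame of $(\Phi,d\varpi)$, $u$ is the vector with $\Phi(u)$ collinear to $\mathbf t$ and $d\varpi(u)=1$, $r=\sqrt{\eta+\|\Phi(u)\|^2}$, $\alpha=J_0^{-1}(\|\Phi(u)\|/r)$, $\theta=\alpha\cos(2\pi N\varpi)$. Formal analogue. $\Phi_{1,0}=df_0$, $\Phi_{k,i}=FCP(\Phi_{k,i-1},\eta_{k,i},\varpi_i,N_{k,i})$ with $\eta_{k,i}=H_i(g_k-\Phi_{k,i-1}^*\langle\cdot,\cdot\rangle)$, $i=1,2,3$, $\Phi_{k+1,0}=\Phi_{k,3}$. This sequence is well defined for every $N_*$ and converges on $0<\rho<1$ to a continuous field $\Phi_\infty$ of injective linear maps with $\Phi_\infty^*\langle\cdot,\cdot\rangle=4\frac{d\rho^2+\rho^2d\varphi^2}{(1-\rho^2)^2}$.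 $\mathbf n^\Phi_\infty$ is the unit normal $\mathbf n$ of $\Phi_\infty$ (third vector of the frame of $(\Phi_\infty,\ell_1)$). Further notation, for $\ell\ge1$. $\Omega_\ell$ is the greatest common divisor of all $N_{k,2},N_{k,3}$ with $k\ge\ell$. $\mathbf F_0^\Phi=\mathbf F_0$ is the frame of $(df_0,\ell_1)$ and $\mathbf F^\Phi_\ell$ the frame of $(\Phi_{\ell,3},\ell_1)$; $\mathrm{Lip}_\rho(\mathbf F^\Phi_\ell)$ is the Lipschitz constant of $\varphi\mapsto\mathbf F^\Phi_\ell(\rho,\varphi)$ (frames viewed as $3\times3$ orthogonal matrices, operator norm). $\mathrm{rot}_\ell^j$ is the rotation mapping the frame $\mathbf F^\Phi_{\ell-1}(\rho,0)$ to $\mathbf F^\Phi_{\ell-1}(\rho,\frac{2j\pi}{7\Omega_\ell})$. $\Gamma_\ell^j=\{(\rho,\varphi):\frac{2j\pi}{7\Omega_\ell}\le\varphi\le\frac{2(j+1)\pi}{7\Omega_\ell}\}$. *)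

(* Defs.v *)
(* MathComp-Analysis, over an arbitrary R : realType. *)
From HB Require Import structures.
From mathcomp Require Import all_boot all_order all_algebra.
From mathcomp Require Import all_classical all_reals all_analysis.

Set Implicit Arguments.
Unset Strict Implicit.
Unset Printing Implicit Defensive.

Import Order.TTheory GRing.Theory Num.Theory.
Import numFieldNormedType.Exports.

Local Open Scope classical_set_scope.
Local Open Scope ring_scope.

(* Conventions. Vectors are rows and linear maps act on the right: a linear map
   R^2 -> E^3 is a matrix Psi : 'M_(2, 3) with Psi(v) = v *m Psi, a linear form
   on R^2 is a column lam with lam(v) = (v *m lam) 0 0, and x (x) lam is
   lam *m x. A point (rho, phi) is a row of length 2, with phi in R a lift of
   the angle. *)

Section Euclidean.
Variable R : realType.

(* The canonical norm of 'rV[R]_n is the sup norm, hence these definitions. *)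
Definition dot n (u v : 'rV[R]_n) : R := \sum_i u 0 i * v 0 i.
Definition enorm n (u : 'rV[R]_n) : R := Num.sqrt (dot u u).
Definition normalize n (u : 'rV[R]_n) : 'rV[R]_n := (enorm u)^-1 *: u.

Definition vec3 (x y z : R) : 'rV[R]_3 := \row_i [:: x; y; z]`_i.

Definition cross (u v : 'rV[R]_3) : 'rV[R]_3 :=
  vec3 (u 0 1 * v 0 2 - u 0 2 * v 0 1)
       (u 0 2 * v 0 0 - u 0 0 * v 0 2)
       (u 0 0 * v 0 1 - u 0 1 * v 0 0).

Definition opnorm n (A : 'M[R]_n) : R :=
  sup [set enorm (u *m A) | u in [set u : 'rV[R]_n | enorm u <= 1]].

Definition hausdorff_dist n (A B : set 'rV[R]_n) : \bar R :=
  maxe (ereal_sup [set ereal_inf [set (enorm (a - b))%:E | b in B] | a in A])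
       (ereal_sup [set ereal_inf [set (enorm (a - b))%:E | a in A] | b in B]).

(* For a 2 pi-periodic F, this is also the Lipschitz constant on R/2piZ with
   its arc-length distance. *)
Definition lipschitz_const n (F : R -> 'M[R]_n) : \bar R :=
  ereal_sup [set (opnorm (F x.1 - F x.2) / `|x.1 - x.2|)%:E |
             x in [set x : R * R | x.1 != x.2]].

End Euclidean.

Section Bessel.
Variable R : realType.

Definition J0 (x : R) : R :=
  limn (series (fun m => (-1) ^+ m / (m`!%:R) ^+ 2 * (x / 2) ^+ (2 * m))).

Definition kappa0 : R :=
  get [set x | [/\ 0 < x, J0 x = 0 & forall y, 0 < y < x -> J0 y != 0]].

Definition J0inv : R -> R := 'pinv_(fun=> 0) `[0, kappa0[ J0.

End Bessel.

Section Frame.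
Variable R : realType.

Definition direct_adapted_basis (lam : 'cV[R]_2) (v w : 'rV[R]_2) : Prop :=
  [/\ 0 < \det (col_mx v w : 'M[R]_2), 0 < (v *m lam) 0 0
    & (w *m lam) 0 0 = 0].

(* For lam != 0 and Psi injective the vectors below do not depend on the
   adapted basis, so an arbitrary one is picked. *)
Definition adapted_basis (lam : 'cV[R]_2) : 'rV[R]_2 * 'rV[R]_2 :=
  get [set vw | direct_adapted_basis lam vw.1 vw.2].

Definition frame_w (Psi : 'M[R]_(2, 3)) (lam : 'cV[R]_2) : 'rV[R]_3 :=
  normalize ((adapted_basis lam).2 *m Psi).

Definition frame_n (Psi : 'M[R]_(2, 3)) (lam : 'cV[R]_2) : 'rV[R]_3 :=
  normalize (cross ((adapted_basis lam).1 *m Psi) ((adapted_basis lam).2 *m Psi)).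

Definition frame_t (Psi : 'M[R]_(2, 3)) (lam : 'cV[R]_2) : 'rV[R]_3 :=
  cross (frame_w Psi lam) (frame_n Psi lam).

(* The rows of the frame matrix are t, w, n. *)
Definition frame (Psi : 'M[R]_(2, 3)) (lam : 'cV[R]_2) : 'M[R]_3 :=
  \matrix_(i < 3) [:: frame_t Psi lam; frame_w Psi lam; frame_n Psi lam]`_i.

End Frame.

Section Process.
Variable R : realType.

Definition polar (rho phi : R) : 'rV[R]_2 := \row_i [:: rho; phi]`_i.

Definition dform (varpi : 'rV[R]_2 -> R) (p : 'rV[R]_2) : 'cV[R]_2 :=
  \col_i 'd varpi p (delta_mx 0 i).

(* Gram matrix of the pulled back metric in the basis (d/drho, d/dphi). *)
Definition pullback (Psi : 'M[R]_(2, 3)) : 'M[R]_2 :=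
  \matrix_(i, j) dot (row i Psi) (row j Psi).

Definition corr_vec (Psi : 'M[R]_(2, 3)) (lam : 'cV[R]_2) : 'rV[R]_2 :=
  get [set u | (exists c : R, u *m Psi = c *: frame_t Psi lam) /\
               (u *m lam) 0 0 = 1].

Definition FCP (Phi : 'rV[R]_2 -> 'M[R]_(2, 3)) (eta varpi : 'rV[R]_2 -> R)
    (N : nat) (p : 'rV[R]_2) : 'M[R]_(2, 3) :=
  let lam := dform varpi p in
  let Phiu := corr_vec (Phi p) lam *m Phi p in
  let r := Num.sqrt (eta p + enorm Phiu ^+ 2) in
  let alpha := J0inv (enorm Phiu / r) in
  let theta := alpha * cos (2 * pi * N%:R * varpi p) in
  Phi p + lam *m (r *: (cos theta *: frame_t (Phi p) lam
                        + sin theta *: frame_n (Phi p) lam) - Phiu).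

Definition a_const : R := 7 / (2 * pi).

(* In varpi and H, the index i ranges over {1, 2, 3}. *)
Definition varpi (i : nat) (p : 'rV[R]_2) : R :=
  match i with
  | 1 => - p 0 0
  | 2 => p 0 0 - a_const * p 0 1
  | _ => p 0 0 + a_const * p 0 1
  end.

Definition H (i : nat) (B : 'M[R]_2) : R :=
  let E := B 0 0 in let F := B 0 1 in let G := B 1 1 in
  match i with
  | 1 => E - G / a_const ^+ 2
  | 2 => G / (2 * a_const ^+ 2) - F / (2 * a_const)
  | _ => G / (2 * a_const ^+ 2) + F / (2 * a_const)
  end.

Definition f0 (p : 'rV[R]_2) : 'rV[R]_3 :=
  let rho := p 0 0 in let phi := p 0 1 in
  2 *: vec3 (rho * cos phi) (rho * sin phi) (Num.sqrt 2 / 2 * rho ^+ 2).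

Definition df0 (p : 'rV[R]_2) : 'M[R]_(2, 3) := 'J f0 p.

Definition g (k : nat) (p : 'rV[R]_2) : 'M[R]_2 :=
  let rho := p 0 0 in
  pullback (df0 p)
  + (4 * \sum_(1 <= n < k.+1) (n + 2)%:R * rho ^+ (2 * (n + 1))) *: delta_mx 0 0
  + (4 * \sum_(1 <= n < k.+1) (n + 1)%:R * rho ^+ (2 * (n + 1))) *: delta_mx 1 1.

Definition step (N : nat -> nat -> nat) (k i : nat)
    (Phi : 'rV[R]_2 -> 'M[R]_(2, 3)) : 'rV[R]_2 -> 'M[R]_(2, 3) :=
  FCP Phi (fun p => H i (g k p - pullback (Phi p))) (varpi i) (N k i).

(* Phi N k i is Phi_{k,i}, for k >= 1 and 0 <= i <= 3. *)
Fixpoint Phi (N : nat -> nat -> nat) (k : nat) :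
    nat -> 'rV[R]_2 -> 'M[R]_(2, 3) :=
  fix Phik (i : nat) : 'rV[R]_2 -> 'M[R]_(2, 3) :=
    match i with
    | i'.+1 => step N k i (Phik i')
    | 0 => match k with
           | 0 | 1 => df0
           | k'.+1 => Phi N k' 3
           end
    end.

(* Pointwise limit of the whole sequence
   Phi_{1,0}, Phi_{1,1}, Phi_{1,2}, Phi_{2,0}, Phi_{2,1}, ... *)
Definition Phi_inf (N : nat -> nat -> nat) (p : 'rV[R]_2) : 'M[R]_(2, 3) :=
  limn (fun n : nat => Phi N (n %/ 3).+1 (n %% 3) p).

Definition ell1 (p : 'rV[R]_2) : 'cV[R]_2 := dform (varpi 1) p.

Definition n_inf (N : nat -> nat -> nat) (p : 'rV[R]_2) : 'rV[R]_3 :=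
  frame_n (Phi_inf N p) (ell1 p).

Definition Fframe (N : nat -> nat -> nat) (l : nat) (p : 'rV[R]_2) : 'M[R]_3 :=
  frame (if l is 0 then df0 p else Phi N l 3 p) (ell1 p).

Definition Lip (N : nat -> nat -> nat) (rho : R) (l : nat) : \bar R :=
  lipschitz_const (fun phi => Fframe N l (polar rho phi)).

End Process.

(* The largest d dividing all N k 2 and N k 3 with k >= l; it is at most
   N l 2 when the latter is positive. *)
Definition Omega (N : nat -> nat -> nat) (l : nat) : nat :=
  \max_(d < (N l 2).+1 |
        `[< forall k, (l <= k)%N -> (d %| N k 2)%N /\ (d %| N k 3)%N >]) d.

Section Sectors.
Variable R : realType.

Definition angle (N : nat -> nat -> nat) (l j : nat) : R :=
  2 * j%:R * pi / (7 * Omega N l)%:R.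

Definition Gamma_sector (N : nat -> nat -> nat) (rho : R) (l j : nat) :
    set 'rV[R]_2 :=
  [set polar rho phi | phi in `[angle N l j, angle N l j.+1]].

Definition Gamma_circle (rho : R) : set 'rV[R]_2 :=
  [set polar rho phi | phi in [set: R]].

(* The frame matrices have the frame vectors as rows, so x |-> x *m rot_mx
   is the linear map sending each vector of the first frame to the
   corresponding vector of the second. *)
Definition rot_mx (N : nat -> nat -> nat) (rho : R) (l j : nat) : 'M[R]_3 :=
  invmx (Fframe N l.-1 (polar rho 0)) *m Fframe N l.-1 (polar rho (angle N l j)).

Definition rot_sector (N : nat -> nat -> nat) (rho : R) (l j : nat) (x : 'rV[R]_3) :
    'rV[R]_3 := x *m rot_mx N rho l j.

End Sectors.

(* Main.v *)
Require Import Defs.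
From HB Require Import structures.
From mathcomp Require Import all_boot all_order all_algebra.
From mathcomp Require Import all_classical all_reals all_analysis.
From mathcomp Require Import ring lra.
Import Order.TTheory GRing.Theory Num.Theory.
Import numFieldNormedType.Exports.
Local Open Scope classical_set_scope.
Local Open Scope ring_scope.

(* Each corrugation expresses the new differential in the frame of the old one
   by a formula in which phi enters only through the Gram matrix of the old
   differential and through cos (2 pi N varpi). Corrugating adds
   eta * (lam (x) lam) to the Gram matrix, so by induction the Gram matrix of
   Phi_{k,0} is g_{k-1}, which depends on rho only, and Phi_{k,0} is injective;
   eta >= 0 follows from a >= 1, i.e. pi <= 7/2. Hence the values of Phi_{l,0} at
   phi and phi + s differ by the rotation Q carrying one frame onto the other.
   When s is a multiple of 2 pi / (7 Omega_l), the later corrugations take the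
   same parameters at both points and commute with Q, so that n_inf too is
   carried along by Q. Replacing Q by rot_l^j then moves the coordinates of the
   normal, a vector of norm at most 1, by two differences of frames at points at
   distance at most 2 pi / (7 Omega_l). *)

(** * Euclidean inner product and norm on row vectors *)

Section Dot.
Context {R : realType} {n : nat}.
Implicit Types (u v w : 'rV[R]_n) (Q : 'M[R]_n).

Lemma dotE u v : dot u v = (u *m v^T) 0 0.
Proof. by rewrite mxE; apply: eq_bigr => i _; rewrite mxE. Qed.

Lemma dotC u v : dot u v = dot v u.
Proof. by apply: eq_bigr => i _; rewrite mulrC. Qed.

Lemma dotDl u v w : dot (u + v) w = dot u w + dot v w.
Proof. by rewrite !dotE mulmxDl mxE. Qed.

Lemma dotDr u v w : dot w (u + v) = dot w u + dot w v.
Proof. by rewrite !(dotC w) dotDl. Qed.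

Lemma dotZl (k : R) u v : dot (k *: u) v = k * dot u v.
Proof. by rewrite !dotE -scalemxAl mxE. Qed.

Lemma dotZr (k : R) u v : dot u (k *: v) = k * dot u v.
Proof. by rewrite !(dotC u) dotZl. Qed.

Lemma dotBl u v w : dot (u - v) w = dot u w - dot v w.
Proof. by rewrite -scaleN1r dotDl dotZl mulN1r. Qed.

Lemma dotBr u v w : dot w (u - v) = dot w u - dot w v.
Proof. by rewrite !(dotC w) dotBl. Qed.

Lemma dot0l v : dot 0 v = 0.
Proof. by rewrite -[0](scale0r v) dotZl mul0r. Qed.

Lemma dot_ge0 u : 0 <= dot u u.
Proof. by apply: sumr_ge0 => i _; rewrite -expr2 sqr_ge0. Qed.

Lemma dot_eq0 u : (dot u u == 0) = (u == 0).
Proof.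
apply/eqP/eqP => [u0|->]; last exact: dot0l.
apply/rowP => i; rewrite mxE; apply/eqP.
have /psumr_eq0P/(_ u0 i isT)/eqP : forall i, true -> 0 <= u 0 i * u 0 i.
  by move=> k _; rewrite -expr2 sqr_ge0.
by rewrite mulf_eq0 orbb.
Qed.

Lemma dot_orthogonal Q u v : Q *m Q^T = 1%:M -> dot (u *m Q) (v *m Q) = dot u v.
Proof. by move=> QQ; rewrite !dotE trmx_mul mulmxA -(mulmxA u) QQ mulmx1. Qed.

Lemma dot_inj u v : (forall w, dot u w = dot v w) -> u = v.
Proof.
move=> uv; apply/eqP; rewrite -subr_eq0 -dot_eq0.
by rewrite dotBl uv subrr.
Qed.

Lemma enorm_ge0 u : 0 <= enorm u.
Proof. exact: sqrtr_ge0. Qed.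

Lemma sqr_enorm u : enorm u ^+ 2 = dot u u.
Proof. by rewrite sqr_sqrtr ?dot_ge0. Qed.

Lemma enorm_eq0 u : (enorm u == 0) = (u == 0).
Proof. by rewrite -dot_eq0 -sqr_enorm sqrf_eq0. Qed.

Lemma enorm0 : enorm (0 : 'rV[R]_n) = 0.
Proof. by apply/eqP; rewrite enorm_eq0. Qed.

Lemma enormN u : enorm (- u) = enorm u.
Proof. by rewrite /enorm -scaleN1r dotZl dotZr !mulN1r opprK. Qed.

Lemma enorm_orthogonal Q u : Q *m Q^T = 1%:M -> enorm (u *m Q) = enorm u.
Proof. by move=> QQ; rewrite /enorm dot_orthogonal. Qed.

Lemma cauchy_schwarz u v : dot u v <= enorm u * enorm v.
Proof.
have [->|u0] := eqVneq u 0; first by rewrite dot0l enorm0 mul0r.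
have [->|v0] := eqVneq v 0; first by rewrite dotC dot0l enorm0 mulr0.
have uP : 0 < enorm u by rewrite lt0r enorm_eq0 u0 enorm_ge0.
have vP : 0 < enorm v by rewrite lt0r enorm_eq0 v0 enorm_ge0.
(* This squared norm equals 2|u||v|(|u||v| - <u, v>), and |u||v| > 0 can be cancelled. *)
have := dot_ge0 (enorm v *: u - enorm u *: v).
rewrite dotBl !dotBr !dotZl !dotZr (dotC v u) -!sqr_enorm => H.
have uvP := mulr_gt0 uP vP.
rewrite -(ler_pM2l uvP); lra.
Qed.

Lemma ler_enormD u v : enorm (u + v) <= enorm u + enorm v.
Proof.
rewrite -(@ler_pXn2r _ 2) ?nnegrE ?addr_ge0 ?enorm_ge0//.
rewrite sqr_enorm sqrrD !sqr_enorm dotDl !dotDr (dotC v u).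
have := cauchy_schwarz u v; lra.
Qed.

Lemma normalize_orthogonal Q u : Q *m Q^T = 1%:M ->
  normalize (u *m Q) = normalize u *m Q.
Proof. by move=> QQ; rewrite /normalize enorm_orthogonal// scalemxAl. Qed.

Lemma dot_normalize u : u != 0 -> dot (normalize u) (normalize u) = 1.
Proof.
move=> u0; have e0 : enorm u != 0 by rewrite enorm_eq0.
by rewrite /normalize dotZl dotZr -sqr_enorm expr2 mulKf// mulVf.
Qed.

End Dot.

(** * Cross product, rotations and Gram matrices in dimension 3 *)

Section Cross.
Context {R : realType}.
Implicit Types (u v w : 'rV[R]_3) (Q : 'M[R]_3).

Lemma ord3P (P : 'I_3 -> Prop) : P 0 -> P 1 -> P 2 -> forall i, P i.
Proof.
move=> P0 P1 P2 [[|[|[|//]]] Hi].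
- by rewrite (_ : Ordinal _ = 0) //; apply/val_inj.
- by rewrite (_ : Ordinal _ = 1) //; apply/val_inj.
- by rewrite (_ : Ordinal _ = 2) //; apply/val_inj.
Qed.

Lemma ord2P (P : 'I_2 -> Prop) : P 0 -> P 1 -> forall i, P i.
Proof.
move=> P0 P1 [[|[|//]] Hi].
- by rewrite (_ : Ordinal _ = 0) //; apply/val_inj.
- by rewrite (_ : Ordinal _ = 1) //; apply/val_inj.
Qed.

Lemma sum3 (V : nmodType) (F : 'I_3 -> V) : \sum_i F i = F 0 + F 1 + F 2.
Proof.
rewrite !big_ord_recr big_ord0 /= add0r.
by congr (F _ + F _ + F _); apply/val_inj.
Qed.

Lemma sum2 (V : nmodType) (F : 'I_2 -> V) : \sum_i F i = F 0 + F 1.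
Proof.
rewrite !big_ord_recr big_ord0 /= add0r.
by congr (F _ + F _); apply/val_inj.
Qed.

Lemma dot3E u v : dot u v = u 0 0 * v 0 0 + u 0 1 * v 0 1 + u 0 2 * v 0 2.
Proof. exact: sum3. Qed.

Lemma crossE u v :
  (cross u v 0 0 = u 0 1 * v 0 2 - u 0 2 * v 0 1) *
  (cross u v 0 1 = u 0 2 * v 0 0 - u 0 0 * v 0 2) *
  (cross u v 0 2 = u 0 0 * v 0 1 - u 0 1 * v 0 0).
Proof. by rewrite !mxE. Qed.

Definition rows3 u v w : 'M[R]_3 := \matrix_(i < 3) [:: u; v; w]`_i.

Lemma row_rows3 u v w :
  (row 0 (rows3 u v w) = u) * (row 1 (rows3 u v w) = v) * (row 2 (rows3 u v w) = w).
Proof. by rewrite !rowK. Qed.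

Lemma rows3E u v w j :
  (rows3 u v w 0 j = u 0 j) * (rows3 u v w 1 j = v 0 j) * (rows3 u v w 2 j = w 0 j).
Proof. by rewrite !mxE. Qed.

Lemma rows3M u v w Q : rows3 (u *m Q) (v *m Q) (w *m Q) = rows3 u v w *m Q.
Proof. by apply/row_matrixP; apply: ord3P; rewrite row_mul !row_rows3. Qed.

Lemma det_mx2 (A : 'M[R]_2) : \det A = A 0 0 * A 1 1 - A 0 1 * A 1 0.
Proof.
have e (k : 'I_2) : lift k (0 : 'I_1) = (if k == 0 then 1 else 0).
  by apply/val_inj; move: k; apply: ord2P.
rewrite (expand_det_row _ 0) sum2 /cofactor !det_mx11 !mxE /= !e /=; ring.
Qed.

Lemma det_rows3 u v w : \det (rows3 u v w) = dot (cross u v) w.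
Proof.
have minor2 i j : cofactor (rows3 u v w) i j =
    (-1) ^+ (i + j) * (rows3 u v w (lift i 0) (lift j 0) * rows3 u v w (lift i 1) (lift j 1)
     - rows3 u v w (lift i 0) (lift j 1) * rows3 u v w (lift i 1) (lift j 0)).
  by rewrite /cofactor det_mx2 !mxE.
rewrite (expand_det_row _ 2) sum3 dot3E !crossE !minor2.
have lE : (lift (0 : 'I_3) (0 : 'I_2) = 1) * (lift (0 : 'I_3) (1 : 'I_2) = 2) *
   (lift (1 : 'I_3) (0 : 'I_2) = 0) * (lift (1 : 'I_3) (1 : 'I_2) = 2) *
   (lift (2 : 'I_3) (0 : 'I_2) = 0) * (lift (2 : 'I_3) (1 : 'I_2) = 1).
  by do !split; apply/val_inj.
rewrite !lE !rows3E /=; ring.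
Qed.

Definition rotation Q := Q *m Q^T = 1%:M /\ \det Q = 1.

(** A vector is determined by its inner products, and the inner product of the cross product with w
    is a determinant, which a factor Q of determinant 1 preserves. *)
Lemma cross_rotation Q u v : rotation Q ->
  cross (u *m Q) (v *m Q) = cross u v *m Q.
Proof.
move=> [QQ dQ]; apply: dot_inj => w.
have -> : w = w *m Q^T *m Q by rewrite -mulmxA (mulmx1C QQ) mulmx1.
by rewrite -det_rows3 rows3M det_mulmx dQ mulr1 det_rows3 dot_orthogonal.
Qed.

Lemma dot_crossl u v : dot (cross u v) u = 0.
Proof. by rewrite dot3E !crossE; ring. Qed.

Lemma dot_crossr u v : dot (cross u v) v = 0.
Proof. by rewrite dot3E !crossE; ring. Qed.

Lemma crossZl (k : R) u v : cross (k *: u) v = k *: cross u v.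
Proof. by apply/rowP; apply: ord3P; rewrite !mxE /=; ring. Qed.

Lemma crossZr (k : R) u v : cross u (k *: v) = k *: cross u v.
Proof. by apply/rowP; apply: ord3P; rewrite !mxE /=; ring. Qed.

Lemma dot_cross u v :
  dot (cross u v) (cross u v) = dot u u * dot v v - dot u v ^+ 2.
Proof. by rewrite !dot3E !crossE; ring. Qed.

Lemma cross_crossr u v w : cross u (cross v w) = dot u w *: v - dot u v *: w.
Proof. by apply/rowP; apply: ord3P; rewrite !mxE !dot3E /=; ring. Qed.

Lemma cross_crossl u v w : cross (cross u v) w = dot u w *: v - dot v w *: u.
Proof. by apply/rowP; apply: ord3P; rewrite !mxE !dot3E /=; ring. Qed.

Lemma rows3_gram u v w (i j : 'I_3) :
  (rows3 u v w *m (rows3 u v w)^T) i j = dot (row i (rows3 u v w)) (row j (rows3 u v w)).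
Proof. by rewrite mxE; apply: eq_bigr => k _; rewrite !mxE. Qed.

Lemma orthonormal_rotation w n : dot w w = 1 -> dot n n = 1 -> dot w n = 0 ->
  rotation (rows3 (cross w n) w n).
Proof.
move=> ww nn wn; split; last first.
  by rewrite det_rows3 cross_crossl ww (dotC n w) wn scale0r subr0 scale1r nn.
have tt : dot (cross w n) (cross w n) = 1 by rewrite dot_cross ww nn wn; ring.
apply/matrixP; apply: ord3P => /=; apply: ord3P => /=;
  rewrite rows3_gram !row_rows3 !mxE /=
    ?(dotC _ (cross w n)) ?tt ?ww ?nn ?wn ?(dotC n w) ?dot_crossl ?dot_crossr //.
Qed.

(* Completing the rows of A and of B by their cross product gives two invertible matrices with
   the same Gram matrix, hence differing by an orthogonal factor. *)
Lemma gram_rotation (A B : 'M[R]_(2, 3)) : pullback A = pullback B ->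
  cross (row 0 A) (row 1 A) != 0 -> exists2 Q, rotation Q & B = A *m Q.
Proof.
move=> AB nA.
have E i j : dot (row i A) (row j A) = dot (row i B) (row j B).
  by move/matrixP/(_ i j): AB; rewrite !mxE.
pose full (C : 'M[R]_(2, 3)) := rows3 (row 0 C) (row 1 C) (cross (row 0 C) (row 1 C)).
have nE : dot (cross (row 0 A) (row 1 A)) (cross (row 0 A) (row 1 A)) =
    dot (cross (row 0 B) (row 1 B)) (cross (row 0 B) (row 1 B)).
  by rewrite !dot_cross !E.
have dA : \det (full A) != 0 by rewrite det_rows3 dot_eq0.
have uA : full A \in unitmx by rewrite unitmxE unitfE.
have G : full A *m (full A)^T = full B *m (full B)^T.
  apply/matrixP; apply: ord3P => /=; apply: ord3P => /=;
    by rewrite !rows3_gram !row_rows3 ?(dotC _ (cross _ _)) ?dot_crossl ?dot_crossr ?E ?nE.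
exists (invmx (full A) *m full B); first split.
- rewrite trmx_mul -mulmxA (mulmxA (full B)) -G -!mulmxA -trmx_mul mulVmx//.
  by rewrite trmx1 mulmx1 mulVmx.
- rewrite det_mulmx det_inv !det_rows3 -nE mulVf// dot_eq0 //.
have fullE C : C = rowsub (widen_ord (isT : 2 <= 3)%N) (full C).
  apply/row_matrixP; apply: ord2P; rewrite row_rowsub.
    by rewrite (_ : widen_ord _ _ = 0) ?row_rows3//; apply/val_inj.
  by rewrite (_ : widen_ord _ _ = 1) ?row_rows3//; apply/val_inj.
by rewrite [LHS]fullE -{1}(mulKVmx uA (full B)) -mul_rowsub_mx -fullE.
Qed.

End Cross.

(** * One corrugation: equivariance under rotations and effect on the Gram matrix *)

Section Corrugation.
Context {R : realType}.
Implicit Types (Psi : 'M[R]_(2, 3)) (lam : 'cV[R]_2) (u v w : 'rV[R]_2).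
Implicit Types (Q : 'M[R]_3).

Lemma pullbackE Psi : pullback Psi = Psi *m Psi^T.
Proof. by apply/matrixP => i j; rewrite !mxE; apply: eq_bigr => k _; rewrite !mxE. Qed.

Lemma pullback_rotation Psi Q : rotation Q -> pullback (Psi *m Q) = pullback Psi.
Proof.
by move=> [QQ _]; rewrite !pullbackE trmx_mul mulmxA -(mulmxA Psi) QQ mulmx1.
Qed.

Lemma frame_w_rotation Psi lam Q : rotation Q ->
  frame_w (Psi *m Q) lam = frame_w Psi lam *m Q.
Proof. by move=> [QQ _]; rewrite /frame_w mulmxA normalize_orthogonal. Qed.

Lemma frame_n_rotation Psi lam Q : rotation Q ->
  frame_n (Psi *m Q) lam = frame_n Psi lam *m Q.
Proof.
move=> rQ; rewrite /frame_n !mulmxA cross_rotation//.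
by rewrite normalize_orthogonal//; case: rQ.
Qed.

Lemma frame_t_rotation Psi lam Q : rotation Q ->
  frame_t (Psi *m Q) lam = frame_t Psi lam *m Q.
Proof.
by move=> rQ; rewrite /frame_t frame_w_rotation// frame_n_rotation// cross_rotation.
Qed.

Lemma frame_rotation Psi lam Q : rotation Q ->
  frame (Psi *m Q) lam = frame Psi lam *m Q.
Proof.
move=> rQ; rewrite -rows3M -frame_w_rotation// -frame_n_rotation//.
by rewrite -frame_t_rotation.
Qed.

(** Since Q is injective and carries [frame_t] along, both sides choose from the same set of
    vectors, and equal sets give the same choice. *)
Lemma corr_vec_rotation Psi lam Q : rotation Q ->
  corr_vec (Psi *m Q) lam = corr_vec Psi lam.
Proof.
move=> rQ; have [QQ _] := rQ; congr get; apply/seteqP.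
have inj (x y : 'rV[R]_3) : x *m Q = y *m Q -> x = y.
  by move=> /(congr1 (mulmx^~ Q^T)); rewrite -!mulmxA QQ !mulmx1.
split=> u [[c uE] ul]; split=> //; exists c.
  by apply: inj; rewrite -mulmxA uE frame_t_rotation// scalemxAl.
by rewrite mulmxA uE frame_t_rotation// scalemxAl.
Qed.

(** The scalars r, alpha and theta agree at p and q, while Phi, its frame and the image of u are
    multiplied by Q, which therefore factors out. *)
Lemma FCP_rotation (Phi : 'rV[R]_2 -> 'M[R]_(2, 3)) (eta varpi : 'rV[R]_2 -> R)
    (N : nat) (p q : 'rV[R]_2) Q :
  rotation Q -> Phi q = Phi p *m Q -> eta q = eta p ->
  dform varpi q = dform varpi p ->
  cos (2 * pi * N%:R * varpi q) = cos (2 * pi * N%:R * varpi p) ->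
  FCP Phi eta varpi N q = FCP Phi eta varpi N p *m Q.
Proof.
move=> rQ PhiE etaE lamE cosE; have [QQ _] := rQ.
rewrite /FCP PhiE etaE lamE cosE (corr_vec_rotation _ _ _ rQ) !mulmxA.
rewrite (frame_t_rotation _ _ _ rQ) (frame_n_rotation _ _ _ rQ).
rewrite (enorm_orthogonal _ _ QQ).
have factor (A : 'M[R]_(2, 3)) (l : 'cV[R]_2) (r c s : R) (t n x : 'rV[R]_3) :
    A *m Q + l *m (r *: (c *: (t *m Q) + s *: (n *m Q)) - x *m Q) =
    (A + l *m (r *: (c *: t + s *: n) - x)) *m Q.
  by rewrite mulmxDl -mulmxA mulmxBl -scalemxAl mulmxDl -!scalemxAl.
exact: factor.
Qed.

Lemma adapted_basisP lam : lam != 0 ->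
  direct_adapted_basis lam (adapted_basis lam).1 (adapted_basis lam).2.
Proof.
move=> lam0.
apply: (@getPex _ [set vw : 'rV[R]_2 * 'rV[R]_2 | direct_adapted_basis lam vw.1 vw.2]).
(* The gradient of lam and its quarter turn: the determinant and lam(v) are both |lam|^2. *)
exists (lam^T, polar (- lam 1 0) (lam 0 0)) => /=.
have pos : 0 < lam 0 0 ^+ 2 + lam 1 0 ^+ 2.
  rewrite lt0r addr_ge0 ?sqr_ge0// andbT; apply: contra lam0.
  rewrite paddr_eq0 ?sqr_ge0// !sqrf_eq0 => /andP[/eqP l0 /eqP l1].
  by apply/eqP/colP; apply: ord2P; rewrite mxE.
have E0 (x y : 'rV[R]_2) j : (col_mx x y : 'M[R]_2) 0 j = x 0 j.
  by rewrite -(col_mxEu x y 0 j); congr (col_mx _ _ _ _); exact/val_inj.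
have E1 (x y : 'rV[R]_2) j : (col_mx x y : 'M[R]_2) 1 j = y 0 j.
  by rewrite -(col_mxEd x y 0 j); congr (col_mx _ _ _ _); exact/val_inj.
split; first by rewrite det_mx2 !E0 !E1 !mxE /=; lra.
- by rewrite mxE sum2 !mxE; lra.
- by rewrite mxE sum2 !mxE /=; lra.
Qed.

Lemma row2E (u : 'rV[R]_2) (A : 'M[R]_(2, 3)) :
  u *m A = u 0 0 *: row 0 A + u 0 1 *: row 1 A.
Proof. by apply/rowP => j; rewrite !mxE sum2. Qed.

(** If x and y had zero cross product, the double product formula would give the relation <y, y> x -
    <y, x> y = 0; freeness then forces y = 0, which contradicts freeness. *)
Lemma cross_neq0 (x y : 'rV[R]_3) :
  (forall a b : R, a *: x + b *: y = 0 -> a = 0 /\ b = 0) -> cross x y != 0.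
Proof.
move=> free; apply/eqP => xy0.
have := cross_crossr y x y; rewrite xy0.
have -> : cross y 0 = 0 by rewrite -(scale0r (0 : 'rV[R]_3)) crossZr !scale0r.
move=> /esym; rewrite -scaleNr => /free[/eqP + _].
rewrite dot_eq0 => /eqP y0.
have /free[_ /eqP] : 0 *: x + 1 *: y = 0 by rewrite y0 scale0r scaler0 addr0.
by rewrite oner_eq0.
Qed.

Section AdaptedBasis.
Variables (lam : 'cV[R]_2) (lam0 : lam != 0).
Let v := (adapted_basis lam).1.
Let w := (adapted_basis lam).2.

Let unit_basis : (col_mx v w : 'M[R]_2) \in unitmx.
Proof. by have [d _ _] := adapted_basisP lam lam0; rewrite unitmxE unitfE gt_eqF. Qed.

Lemma adapted_basis_span u : exists a b, u = a *: v + b *: w.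
Proof.
pose c : 'M[R]_(1, 1 + 1) := u *m invmx (col_mx v w : 'M[R]_2).
have -> : u = c *m col_mx v w by rewrite mulmxKV.
exists (lsubmx c 0 0), (rsubmx c 0 0); rewrite -{1}(hsubmxK c) mul_row_col.
by rewrite -!mul_scalar_mx -!mx11_scalar.
Qed.

Lemma adapted_basis_free (a b : R) : a *: v + b *: w = 0 -> a = 0 /\ b = 0.
Proof.
rewrite -!mul_scalar_mx -mul_row_col.
move=> /(congr1 (mulmx^~ (invmx (col_mx v w : 'M[R]_2)))).
rewrite mulmxK// mul0mx => /matrixP ab0; split.
  by have := etrans (esym (row_mxEl (a%:M : 'M[R]_1) b%:M 0 0)) (ab0 0 _);
    rewrite !mxE mulr1n.
by have := etrans (esym (row_mxEr (a%:M : 'M[R]_1) (b%:M : 'M[R]_1) 0 0)) (ab0 0 _);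
    rewrite !mxE mulr1n.
Qed.

Lemma form_adapted_gt0 : 0 < (v *m lam) 0 0.
Proof. by have [] := adapted_basisP lam lam0. Qed.

Lemma form_adapted_eq0 : w *m lam = 0.
Proof.
by have [_ _ wl] := adapted_basisP lam lam0; apply/matrixP => i j; rewrite !ord1 wl mxE.
Qed.

Lemma ker_adapted u : u *m lam = 0 -> exists b, u = b *: w.
Proof.
have [a [b ->]] := adapted_basis_span u; rewrite mulmxDl -!scalemxAl form_adapted_eq0.
rewrite scaler0 addr0 => /matrixP/(_ 0 0)/eqP; rewrite !mxE mulf_eq0.
have := form_adapted_gt0; rewrite mxE => /gt_eqF ->; rewrite orbF => /eqP ->.
by exists b; rewrite scale0r add0r.
Qed.

Section Injective.
Variables (Psi : 'M[R]_(2, 3)) (Psi_free : row_free Psi).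

Lemma cross_adapted_neq0 : cross (v *m Psi) (w *m Psi) != 0.
Proof.
apply: cross_neq0 => a b; rewrite !scalemxAl -mulmxDl => /eqP.
by rewrite mulmx_free_eq0// => /eqP/adapted_basis_free.
Qed.

Lemma image_adapted_neq0 : w *m Psi != 0.
Proof.
rewrite mulmx_free_eq0//; apply/eqP => w0.
have /adapted_basis_free[_ /eqP] : 0 *: v + 1 *: w = 0.
  by rewrite w0 scale0r scaler0 addr0.
by rewrite oner_eq0.
Qed.

Lemma frame_is_rotation : rotation (frame Psi lam).
Proof.
apply: orthonormal_rotation.
- exact: dot_normalize image_adapted_neq0.
- exact: dot_normalize cross_adapted_neq0.
- by rewrite dotZl dotZr dotC dot_crossr !mulr0.
Qed.

Lemma image_ker u : u *m lam = 0 -> exists k, u *m Psi = k *: frame_w Psi lam.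
Proof.
move=> /ker_adapted[b ->]; exists (b * enorm (w *m Psi)).
rewrite -scalemxAl /frame_w /normalize -/w scalerA mulfK//.
by rewrite enorm_eq0 image_adapted_neq0.
Qed.

Lemma corr_vecP : (exists c : R, corr_vec Psi lam *m Psi = c *: frame_t Psi lam) /\
  (corr_vec Psi lam *m lam) 0 0 = 1.
Proof.
set x := v *m Psi; set y := w *m Psi.
have y0 : dot y y != 0 by rewrite dot_eq0 image_adapted_neq0.
have vl : (v *m lam) 0 0 != 0 by rewrite gt_eqF// form_adapted_gt0.
pose k := (dot y y * (v *m lam) 0 0)^-1.
apply: (@getPex _ [set u | (exists c : R, u *m Psi = c *: frame_t Psi lam) /\
                           (u *m lam) 0 0 = 1]).
(* The image of <y, y> v - <y, x> w is the double product y ^ (x ^ y), a multiple of t because y is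
   along w and x ^ y along n; the factor k makes lam(u) equal to 1. *)
exists (k *: (dot y y *: v - dot y x *: w)); split; last first.
  rewrite -scalemxAl mulmxBl -!scalemxAl form_adapted_eq0 scaler0 subr0 scalerA.
  rewrite [v *m lam]mx11_scalar scale_scalar_mx mxE mulr1n /k -mulrA mulVf//.
  by rewrite mulf_neq0.
exists (k * (enorm y * enorm (cross x y))).
rewrite -scalemxAl mulmxBl -!scalemxAl -/x -/y -cross_crossr -scalerA; congr (_ *: _).
rewrite /frame_t /frame_w /frame_n -/v -/w -/x -/y /normalize crossZl crossZr !scalerA.
have ey : enorm y != 0 by rewrite enorm_eq0 image_adapted_neq0.
have ec : enorm (cross x y) != 0 by rewrite enorm_eq0 cross_adapted_neq0.
rewrite -[LHS]scale1r; congr (_ *: _).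
by field; rewrite ey ec.
Qed.

(* The corrugation leaves the images of ker lam unchanged and replaces the
   orthogonal vector Psi(u) by z. *)
Lemma dot_corrugate (z : 'rV[R]_3) (eta : R) u' u'' :
  let Psiu := corr_vec Psi lam *m Psi in
  let Psi' := Psi + lam *m (z - Psiu) in
  dot z (frame_w Psi lam) = 0 -> dot z z = eta + dot Psiu Psiu ->
  dot (u' *m Psi') (u'' *m Psi') =
  dot (u' *m Psi) (u'' *m Psi) + eta * ((u' *m lam) 0 0 * (u'' *m lam) 0 0).
Proof.
have [[c uE] lu] := corr_vecP; set u := corr_vec Psi lam in uE lu *.
move=> Psiu Psi' zw zz.
have decomp (X : 'rV[R]_2) : exists k, let a := (X *m lam) 0 0 in
    X *m Psi = k *: frame_w Psi lam + a *: Psiu /\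
    X *m Psi' = k *: frame_w Psi lam + a *: z.
  set a := (X *m lam) 0 0.
  have Xl : X *m lam = a%:M by rewrite [LHS]mx11_scalar.
  have [|k kE] := image_ker (X - a *: u).
    rewrite mulmxBl -scalemxAl Xl [u *m lam]mx11_scalar lu.
    by rewrite scale_scalar_mx mulr1 subrr.
  exists k; have XE : X *m Psi = k *: frame_w Psi lam + a *: Psiu.
    by rewrite -kE mulmxBl -scalemxAl subrK.
  split=> //; rewrite mulmxDr mulmxA Xl mul_scalar_mx XE scalerBr.
  by rewrite addrACA subrr addr0.
have wu : dot (frame_w Psi lam) Psiu = 0.
  by rewrite /Psiu uE dotZr dotC dot_crossl mulr0.
have [k' [-> ->]] := decomp u'; have [k'' [-> ->]] := decomp u''.
move: (frame_w Psi lam) (Psiu) zw zz wu {decomp uE} => f x zf zz fx.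
rewrite !(dotDl, dotDr, dotZl, dotZr) zz (dotC x f) (dotC f z) zf fx.
ring.
Qed.

End Injective.
End AdaptedBasis.

Section FCPGram.
Variables (Phi : 'rV[R]_2 -> 'M[R]_(2, 3)) (eta varpi : 'rV[R]_2 -> R) (N : nat).
Variables (p : 'rV[R]_2) (Phi_free : row_free (Phi p)).
Hypotheses (lam0 : dform varpi p != 0) (eta0 : 0 <= eta p).

(** As t and n are orthonormal and orthogonal to w, the vector r (cos theta t + sin theta n) is
    orthogonal to w with squared norm r^2 = eta + |Phi(u)|^2, as [dot_corrugate] requires. *)
Lemma dot_FCP (u' u'' : 'rV[R]_2) : let lam := dform varpi p in
  dot (u' *m FCP Phi eta varpi N p) (u'' *m FCP Phi eta varpi N p) =
  dot (u' *m Phi p) (u'' *m Phi p) +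
  eta p * ((u' *m lam) 0 0 * (u'' *m lam) 0 0).
Proof.
move=> lam; rewrite /FCP -/lam.
set r := Num.sqrt _; set th := J0inv _ * _.
have [nn tt] : dot (frame_n (Phi p) lam) (frame_n (Phi p) lam) = 1 /\
    dot (frame_t (Phi p) lam) (frame_t (Phi p) lam) = 1.
  have [/matrixP FF _] := frame_is_rotation lam lam0 (Phi p) Phi_free.
  by split; [move: (FF 2 2)|move: (FF 0 0)]; rewrite rows3_gram !row_rows3 !mxE.
have [tw tn] : dot (frame_t (Phi p) lam) (frame_w (Phi p) lam) = 0 /\
    dot (frame_t (Phi p) lam) (frame_n (Phi p) lam) = 0.
  by rewrite dot_crossl dot_crossr.
have nw : dot (frame_n (Phi p) lam) (frame_w (Phi p) lam) = 0.
  by rewrite dotZl dotZr dot_crossr !mulr0.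
have zw (t n f : 'rV[R]_3) (a b c : R) : dot t f = 0 -> dot n f = 0 ->
    dot (a *: (b *: t + c *: n)) f = 0.
  by move=> tf nf; rewrite !(dotZl, dotDl) tf nf; ring.
have zz (t n : 'rV[R]_3) (a b : R) : dot t t = 1 -> dot n n = 1 -> dot t n = 0 ->
    dot (a *: (cos b *: t + sin b *: n)) (a *: (cos b *: t + sin b *: n)) = a ^+ 2.
  move=> tt' nn' tn'; rewrite !(dotDl, dotDr, dotZl, dotZr) (dotC n t) tt' nn' tn'.
  by rewrite -[in RHS](mulr1 (a ^+ 2)) -[X in _ = _ * X](cos2Dsin2 b); ring.
apply: dot_corrugate => //; first exact: zw.
by rewrite zz// sqr_sqrtr sqr_enorm// addr_ge0// dot_ge0.
Qed.

Lemma pullback_FCP : pullback (FCP Phi eta varpi N p) =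
  pullback (Phi p) + eta p *: (dform varpi p *m (dform varpi p)^T).
Proof.
apply/matrixP => i j; rewrite [LHS]mxE !rowE dot_FCP -!rowE !mxE.
by rewrite big_ord_recl big_ord0 addr0 !mxE.
Qed.

(** With eta >= 0 the corrugation can only lengthen images, so a vector that it kills is already
    killed by [Phi p]. *)
Lemma row_free_FCP : row_free (FCP Phi eta varpi N p).
Proof.
apply: inj_row_free => u u0; apply/eqP.
rewrite -(mulmx_free_eq0 u Phi_free) -dot_eq0 eq_le dot_ge0 andbT.
have /= := dot_FCP u u; rewrite u0 dot0l -expr2 => e; rewrite [leRHS]e.
by rewrite lerDl mulr_ge0 ?sqr_ge0.
Qed.

End FCPGram.
End Corrugation.

(** * Limits of matrix sequences under multiplication by a fixed matrix *)

Section Limits.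
Context {R : realType}.

Lemma cvg_mx {T : Type} (F : set_system T) (FF : Filter F) (m n : nat)
    (f : T -> 'M[R]_(m, n)) (M : 'M[R]_(m, n)) :
  (forall i j, f x i j @[x --> F] --> M i j) -> f @ F --> M.
Proof.
move=> fM A [P MP PA]; rewrite /= /nbhs /=.
apply: (@filterS _ F _ (fun x => forall ij : 'I_m * 'I_n, P ij.1 ij.2 (f x ij.1 ij.2))).
  by move=> x Px; apply: PA => i j; exact: (Px (i, j)).
by apply: filter_forall => -[i j]; exact: fM (MP i j).
Qed.

Lemma cvg_mulmxr {T : Type} (F : set_system T) (FF : Filter F) (m n p : nat)
    (f : T -> 'M[R]_(m, n)) (M : 'M[R]_(m, n)) (Q : 'M[R]_(n, p)) :
  f @ F --> M -> f x *m Q @[x --> F] --> M *m Q.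
Proof.
move=> fM; apply: cvg_mx => i j; rewrite mxE.
rewrite (_ : (fun x => _) = fun x => \sum_k f x i k * Q k j); last first.
  by apply/funext => x; rewrite mxE.
apply: cvg_big => [|k _]; first exact: add_continuous.
apply: cvgMr_tmp.
exact: (@cvg_comp _ _ _ f (fun A : 'M[R]_(m, n) => A i k) _ _ _ fM
  (@coord_continuous R m n i k M)).
Qed.

(* A divergent sequence has the junk limit 0, which is compatible with the
   product as well. *)
Lemma lim_mulmxr (m n : nat) (u v : nat -> 'M[R]_(m, n)) (Q : 'M[R]_n) :
  Q \in unitmx -> (\forall k \near \oo, v k = u k *m Q) -> limn v = limn u *m Q.
Proof.
move=> Qu uv.
have vlim (L : 'M[R]_(m, n)) : u @ \oo --> L -> v @ \oo --> L *m Q.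
  move=> uL; apply: cvg_trans (cvg_mulmxr \oo _ _ _ _ u L Q uL).
  by apply: near_eq_cvg; apply: filterS uv => k ->.
have [uc|du] := pselect (cvg (u @ \oo)).
  by apply: cvg_lim => //; exact: vlim.
have dv : ~ cvg (v @ \oo).
  move=> vc; apply: du; apply/cvg_ex; exists (limn v *m invmx Q).
  apply: cvg_trans (cvg_mulmxr \oo _ _ _ _ v _ (invmx Q) vc).
  by apply: near_eq_cvg; apply: filterS uv => k ->; rewrite mulmxK.
rewrite (dvgP du) (dvgP dv); apply/matrixP => i j.
by rewrite !mxE big1// => k _; rewrite mxE mul0r.
Qed.

End Limits.

(** * The explicit data: a bound on pi, and the differentials of the phases and of f_0 *)

Section Data.
Context {R : realType}.

(* With t = tan (pi / 8), duplication gives t ^ 2 + 2 t = tan (pi / 4) = 1,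
   and pi / 8 <= t. *)
Lemma pi_le : (pi : R) <= 7 / 2.
Proof.
have pi0 := @pi_gt0 R.
pose x : R := pi / 8; pose t := tan x.
have cosP y : 0 <= y <= x -> 0 < cos (y : R).
  by move=> /andP[y0 yx]; apply: cos_gt0_pihalf; move: yx; rewrite /x; lra.
have xE : x *+ 2 = pi / 4 by rewrite /x mulr2n; lra.
have cx : cos x != 0 by rewrite gt_eqF// cosP ?lexx ?andbT// /x; lra.
have xt : x <= t.
  have x0 : 0 < x by rewrite /x; lra.
  have dtan y : 0 <= y <= x -> is_derive y 1 (@tan R) ((cos y) ^- 2).
    by move=> yx; apply: is_derive_tan; rewrite gt_eqF// cosP.
  have [y| |c] := @MVT R (@tan R) (fun y => (cos y) ^- 2) 0 x x0.
  - by rewrite in_itv /= => /andP[y0 yx]; apply: dtan; rewrite !ltW.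
  - by apply: derivable_within_continuous => y; rewrite in_itv /= => /dtan [].
  rewrite in_itv /= tan0 !subr0 => /andP[c0 cx'] tE.
  have cP : 0 < cos c by rewrite cosP// !ltW.
  rewrite /t tE ler_peMl ?(ltW x0)// invf_ge1 ?exprn_gt0// exprn_ile1 ?cos_le1 ?(ltW cP).
have t0 : 0 < t by rewrite (lt_le_trans _ xt)// /x; lra.
have := tan_mulr2n cx; rewrite xE tan_piquarter -/t => tE.
have d0 : 1 - t ^+ 2 != 0.
  by apply/eqP => d0; move: tE; rewrite d0 invr0 mulr0 => /eqP; rewrite oner_eq0.
have t2 : t *+ 2 = 1 - t ^+ 2 by apply: (mulIf (invr_neq0 d0)); rewrite -tE mulfV.
have tb : t < 7 / 16.
  rewrite ltNge; apply/negP => tb; have : (7 / 16) ^+ 2 <= t ^+ 2.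
    by rewrite ler_pXn2r// nnegrE ?ltW// divr_gt0.
  by rewrite (_ : t ^+ 2 = 1 - t *+ 2); [rewrite mulr2n; lra | rewrite t2; ring].
by move: xt; rewrite /x; lra.
Qed.

Lemma is_diff_derive1 (f : R -> R) (x df : R) :
  is_derive x 1 f df -> is_diff x f ( *:%R ^~ df).
Proof.
move=> dfx; apply: DiffDef; first exact/derivable1_diffP.
by rewrite deriv1E// derive1E derive_val.
Qed.

Lemma is_diff_coord (m n : nat) (i : 'I_m) (j : 'I_n) (M : 'M[R]_(m, n)) :
  is_diff M (fun A : 'M[R]_(m, n) => A i j) (fun A : 'M[R]_(m, n) => A i j).
Proof.
have @f : {linear 'M[R]_(m, n) -> R}.
  by exists (fun A : 'M[R]_(_, _) => A i j); do 2![eexists]; do ?[constructor];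
     rewrite ?mxE// => ? *; rewrite ?mxE//; move=> ?; rewrite !mxE.
apply: DiffDef; first exact: differentiable_coord.
by rewrite (_ : (fun _ => _) = f) // diff_lin//; exact: coord_continuous.
Qed.

Lemma dform_linear (f : 'rV[R]_2 -> R) (lam : 'cV[R]_2) (p : 'rV[R]_2) :
  (forall q, f q = q 0 0 * lam 0 0 + q 0 1 * lam 1 0) -> dform f p = lam.
Proof.
move=> fE; have := is_diff_coord _ _ 0 0 p; have := is_diff_coord _ _ 0 1 p => d1 d0.
pose x (q : 'rV[R]_2) := q 0 0; pose y (q : 'rV[R]_2) := q 0 1.
have df : is_diff p f (lam 0 0 *: x + lam 1 0 *: y).
  rewrite (_ : f = lam 0 0 *: x + lam 1 0 *: y).
    exact: is_diffD.
  by apply/funext => q; rewrite fE mulrC [X in _ + X]mulrC.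
apply/colP => i; rewrite mxE diff_val.
by move: i; apply: ord2P; rewrite -[LHS]/(_ * _ + _ * _) /x /y !mxE/=; ring.
Qed.

(** The differential of [varpi i] is the same at all points; the fallback branch follows that of
    [varpi]. *)
Definition varpi_form (i : nat) : 'cV[R]_2 :=
  match i with
  | 1 => \col_i [:: -1; 0]`_i
  | 2 => \col_i [:: 1; - a_const R]`_i
  | _ => \col_i [:: 1; a_const R]`_i
  end.

Lemma dform_varpi i p : dform (@varpi R i) p = varpi_form i.
Proof.
by apply: dform_linear => q; case: i => [|[|[|i]]]; rewrite /= !mxE /=; ring.
Qed.

Lemma polarE (rho phi : R) : (polar rho phi 0 0 = rho) * (polar rho phi 0 1 = phi).
Proof. by rewrite !mxE. Qed.

Lemma df0_polar (rho phi : R) :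
  (row 0 (df0 (polar rho phi)) = 2 *: vec3 (cos phi) (sin phi) (Num.sqrt 2 * rho)) *
  (row 1 (df0 (polar rho phi)) = 2 *: vec3 (- (rho * sin phi)) (rho * cos phi) 0).
Proof.
have d0 := is_diff_coord _ _ 0 0 (polar rho phi).
have d1 := is_diff_coord _ _ 0 1 (polar rho phi).
pose r (q : 'rV[R]_2) := q 0 0; pose s (q : 'rV[R]_2) := q 0 1.
have dcos : is_diff (polar rho phi) (cos \o s) (( *:%R ^~ (- sin phi)) \o s).
  apply: is_diff_comp; rewrite [s _](polarE rho phi).
  exact: is_diff_derive1.
have dsin : is_diff (polar rho phi) (sin \o s) (( *:%R ^~ (cos phi)) \o s).
  apply: is_diff_comp; rewrite [s _](polarE rho phi).
  exact: is_diff_derive1.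
pose Z (x : 'rV[R]_3) (k : R) := k *: x.
(* Written as a sum of constant vectors with scalar coefficients, f_0 is differentiated by the sum,
   product and chain rules. *)
have f0E : @f0 R = (Z (vec3 2 0 0) \o (r * (cos \o s))) +
    (Z (vec3 0 2 0) \o (r * (sin \o s))) + (Z (vec3 0 0 (Num.sqrt 2)) \o (r * r)).
  apply/funext => q; apply/rowP; apply: ord3P;
    rewrite /f0 !fctE /= /Z /r /s !mxE /=; by field.
have dZ (x : 'rV[R]_3) (k : R) : is_diff k (Z x) (Z x) by exact: is_diff_scalel.
have Df0 : is_diff (polar rho phi) (@f0 R)
   ((Z (vec3 2 0 0) \o (rho *: (( *:%R ^~ (- sin phi)) \o s) + cos phi *: r)) +
    (Z (vec3 0 2 0) \o (rho *: (( *:%R ^~ (cos phi)) \o s) + sin phi *: r)) +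
    (Z (vec3 0 0 (Num.sqrt 2)) \o (rho *: r + rho *: r))).
  have dM (h dh : 'rV[R]_2 -> R) (c : R) : h (polar rho phi) = c ->
      is_diff (polar rho phi) h dh ->
      is_diff (polar rho phi) (r * h) (rho *: dh + c *: r).
    move=> <- dh'; have := @is_diffM _ _ r h r dh _ d0 dh'.
    by rewrite [r _](polarE rho phi).
  have comp (x : 'rV[R]_3) (h dh : 'rV[R]_2 -> R) :
      is_diff (polar rho phi) h dh -> is_diff (polar rho phi) (Z x \o h) (Z x \o dh).
    by move=> h'; exact: (@is_diff_comp _ _ _ _ _ _ _ _ _ h' (dZ x _)).
  have c1 := comp (vec3 2 0 0) _ _ (dM _ _ _ (congr1 cos (polarE rho phi).2) dcos).
  have c2 := comp (vec3 0 2 0) _ _ (dM _ _ _ (congr1 sin (polarE rho phi).2) dsin).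
  have c3 := comp (vec3 0 0 (Num.sqrt 2)) _ _ (dM _ _ _ (polarE rho phi).1 d0).
  rewrite f0E.
  exact: (@is_diffD _ _ _ _ _ _ _ _ (@is_diffD _ _ _ _ _ _ _ _ c1 c2) c3).
have row_df0 i : row i (df0 (polar rho phi)) = 'd (@f0 R) (polar rho phi) (delta_mx 0 i).
  by rewrite rowE mul_rV_lin1.
rewrite !row_df0 diff_val.
split; apply/rowP; apply: ord3P;
    rewrite !fctE /= /Z /r /s !mxE /= /GRing.scale /=; ring.
Qed.
End Data.

(** * The metrics g_k and their coefficients on the squares of the forms ell_i *)

Section GramInduction.
Context {R : realType}.
Notation a := (a_const R).

Lemma a_const_ge1 : 1 <= a.
Proof. by rewrite /a_const ler_pdivlMr ?mul1r; have := @pi_le R; have := @pi_gt0 R; lra. Qed.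

Lemma varpi_form_neq0 i : varpi_form i != 0 :> 'cV[R]_2.
Proof.
apply/eqP => /matrixP/(_ 0 0) /eqP; case: i => [|[|[|i]]]; rewrite !mxE /=.
all: by rewrite ?oppr_eq0 oner_eq0.
Qed.

Lemma pullback_df0 (rho phi : R) : pullback (df0 (polar rho phi)) =
  (4 * (1 + 2 * rho ^+ 2)) *: delta_mx 0 0 + (4 * rho ^+ 2) *: delta_mx 1 1.
Proof.
have sq2 : Num.sqrt 2 ^+ 2 = 2 :> R by rewrite sqr_sqrtr.
have cs := cos2Dsin2 phi.
apply/matrixP; apply: ord2P; apply: ord2P; rewrite [LHS]mxE !df0_polar dot3E !mxE /=.
- rewrite -[X in _ * (X + _)]cs -[X in _ + X * rho ^+ 2]sq2; ring.
- ring.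
- ring.
- rewrite -[rho ^+ 2 in RHS]mulr1 -cs; ring.
Qed.

(** The metric of f_0 is diagonal, with both coefficients positive when rho > 0. *)
Lemma row_free_df0 (rho phi : R) : 0 < rho -> row_free (df0 (polar rho phi)).
Proof.
move=> rho0; apply: inj_row_free => u u0.
have : dot (u *m df0 (polar rho phi)) (u *m df0 (polar rho phi)) = 0 by rewrite u0 dot0l.
rewrite dotE trmx_mul mulmxA -(mulmxA u) -pullbackE pullback_df0.
rewrite !mxE sum2 !mxE !sum2 !mxE /= => /eqP.
rewrite [X in X == 0](_ : _ = 4 * (1 + 2 * rho ^+ 2) * u 0 0 ^+ 2 +
  4 * rho ^+ 2 * u 0 1 ^+ 2); last ring.
have r2 : 0 < rho ^+ 2 by rewrite exprn_gt0.
have p1 : 0 < 4 * (1 + 2 * rho ^+ 2) by lra.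
have p2 : 0 < 4 * rho ^+ 2 by lra.
rewrite paddr_eq0; [|exact: mulr_ge0 (ltW p1) (sqr_ge0 _)
                    |exact: mulr_ge0 (ltW p2) (sqr_ge0 _)].
rewrite [_ * _ == 0]mulf_eq0 [X in _ && X]mulf_eq0 (gt_eqF p1) (gt_eqF p2) !sqrf_eq0 /=.
by move=> /andP[/eqP u00 /eqP u01]; apply/rowP; apply: ord2P; rewrite mxE.
Qed.

Lemma g0 (p : 'rV[R]_2) : g 0 p = pullback (df0 p).
Proof. by rewrite /g !big_geq// !mulr0 !scale0r !addr0. Qed.

Lemma g_polarE k (rho phi : R) : g k (polar rho phi) =
  ((4 * (1 + 2 * rho ^+ 2)) *: delta_mx 0 0 + (4 * rho ^+ 2) *: delta_mx 1 1)
  + (4 * \sum_(1 <= n < k.+1) (n + 2)%:R * rho ^+ (2 * (n + 1))) *: delta_mx 0 0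
  + (4 * \sum_(1 <= n < k.+1) (n + 1)%:R * rho ^+ (2 * (n + 1))) *: delta_mx 1 1.
Proof. by rewrite /g (polarE rho phi).1 pullback_df0. Qed.

Lemma g_polar k (rho phi phi' : R) : g k (polar rho phi) = g k (polar rho phi').
Proof. exact: etrans (g_polarE k rho phi) (esym (g_polarE k rho phi')). Qed.

Lemma gS k (p : 'rV[R]_2) : g k.+1 p = g k p +
  ((4 * ((k.+1 + 2)%:R * p 0 0 ^+ (2 * (k.+1 + 1)))) *: delta_mx 0 0 +
   (4 * ((k.+1 + 1)%:R * p 0 0 ^+ (2 * (k.+1 + 1)))) *: delta_mx 1 1).
Proof.
rewrite /g !(big_nat_recr k.+1)//= !mulrDr !scalerDl.
by rewrite -!addrA; congr (_ + (_ + _)); rewrite addrCA.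
Qed.

(** The matrix of ell_i (x) ell_i, the direction along which corrugation i changes the metric. *)
Definition square i : 'M[R]_2 := varpi_form i *m (varpi_form i)^T.

Lemma HE i (A B : 'M[R]_2) (c : R) : H i (A + c *: B) = H i A + c * H i B.
Proof. by case: i => [|[|[|i]]]; rewrite /= !mxE; ring. Qed.

Let a0 : a != 0.
Proof. by rewrite gt_eqF// (lt_le_trans ltr01 a_const_ge1). Qed.

(** This duality ensures that one corrugation does not alter the coefficients used by the next ones
    of the same stage. *)
Lemma H_square i j : (1 <= i <= 3)%N -> (1 <= j <= 3)%N ->
  H i (square j) = (i == j)%:R.
Proof.
case: i => [|[|[|[|i]]]] //; case: j => [|[|[|[|j]]]] // _ _;
  rewrite /= /square !mxE !big_ord_recl !big_ord0 !mxE /=; by field.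
Qed.

Lemma H_decomposition (B : 'M[R]_2) : B 0 1 = B 1 0 ->
  B = H 1 B *: square 1 + H 2 B *: square 2 + H 3 B *: square 3.
Proof.
move=> sB; apply/matrixP; apply: ord2P; apply: ord2P;
  rewrite /square !mxE !big_ord_recl !big_ord0 !mxE /= -?sB; by field.
Qed.

(** For i = 1 the value is 4 s (m + 2 - (m + 1) / a^2), and a >= 1; for i = 2, 3 the off-diagonal
    entry vanishes, leaving 2 s (m + 1) / a^2. *)
Lemma H_increment_ge0 i (m : nat) (s : R) : 0 <= s -> (1 <= i <= 3)%N ->
  0 <= H i ((4 * ((m + 2)%:R * s)) *: delta_mx 0 0 + (4 * ((m + 1)%:R * s)) *: delta_mx 1 1).
Proof.
move=> s0; have a1 := a_const_ge1.
have m0 : 0 <= m%:R :> R by [].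
have a2 : a ^- 2 <= 1 by rewrite invf_le1 ?exprn_gt0 ?exprn_ege1// (lt_le_trans ltr01).
have a2p : 0 <= a ^- 2 by rewrite invr_ge0 exprn_ge0// (le_trans ler01).
case: i => [|[|[|[|i]]]] // _; rewrite /= !mxE /= !natrD.
- rewrite (_ : _ - _ = 4 * s * (m%:R + 2 - (m%:R + 1) * a ^- 2)); last by ring.
  by rewrite mulr_ge0 ?mulr_ge0//; nra.
- rewrite (_ : _ - _ = 2 * s * (m%:R + 1) * a ^- 2); last by field.
  by rewrite !mulr_ge0// addr_ge0.
- rewrite (_ : _ + _ = 2 * s * (m%:R + 1) * a ^- 2); last by field.
  by rewrite !mulr_ge0// addr_ge0.
Qed.

End GramInduction.

(** * The whole sequence and its limit: Gram matrices and transport by a rotation *)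

Section FormalAnalogue.
Context {R : realType}.
Variable N : nat -> nat -> nat.
Implicit Types (F : 'rV[R]_2 -> 'M[R]_(2, 3)) (p q : 'rV[R]_2) (Q : 'M[R]_3).

Lemma step_gram k i F p : row_free (F p) -> 0 <= H i (g k p - pullback (F p)) ->
  pullback (step N k i F p) = pullback (F p) + H i (g k p - pullback (F p)) *: square i
  /\ row_free (step N k i F p).
Proof.
move=> Ffree eta0; have lam0 := @varpi_form_neq0 R i; rewrite -(dform_varpi i p) in lam0.
split; last exact: row_free_FCP.
by rewrite /step pullback_FCP// dform_varpi.
Qed.

(** By duality the three steps add [H i D *: square i] in turn, with D the initial defect
    throughout; for symmetric D these terms sum to D. *)
Lemma three_steps_gram k F p : row_free (F p) ->
  let D := g k p - pullback (F p) in D 0 1 = D 1 0 ->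
  (forall i, (1 <= i <= 3)%N -> 0 <= H i D) ->
  let F3 := step N k 3 (step N k 2 (step N k 1 F)) in
  pullback (F3 p) = g k p /\ row_free (F3 p).
Proof.
move=> Ffree D sD D0 /=.
have [G1 F1] := step_gram k 1 F p Ffree (D0 1%N isT).
have D1 : g k p - pullback (step N k 1 F p) = D + - H 1 D *: square 1.
  by rewrite G1 opprD addrA scaleNr.
have h2 : H 2 (g k p - pullback (step N k 1 F p)) = H 2 D.
  by rewrite D1 HE H_square// mulr0 addr0.
have [|G2 F2] := step_gram k 2 (step N k 1 F) p F1; first by rewrite h2 D0.
rewrite h2 in G2.
have D2 : g k p - pullback (step N k 2 (step N k 1 F) p) =
    D + - H 1 D *: square 1 + - H 2 D *: square 2.
  by rewrite G2 opprD [LHS]addrA D1 !scaleNr.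
have h3 : H 3 (g k p - pullback (step N k 2 (step N k 1 F) p)) = H 3 D.
  by rewrite D2 !HE !H_square// !mulr0 !addr0.
have [|G3 F3] := step_gram k 3 (step N k 2 (step N k 1 F)) p F2; first by rewrite h3 D0.
rewrite h3 in G3; split=> //; rewrite G3 G2 G1 -/D -!addrA.
by rewrite (addrA (_ *: square 1)) -(H_decomposition D sD) /D addrC subrK.
Qed.

(** The indices are shifted by one: Phi_{k+1,0} is the outcome of stage k, and for k = 0 the sums in
    g are empty, leaving the metric of f_0. The defect met by stage k+1 is thus the last summand of
    g_{k+1}. *)
Lemma Phi_gram k (rho phi : R) : 0 < rho ->
  pullback (Phi N k.+1 0 (polar rho phi)) = g k (polar rho phi) /\
  row_free (Phi N k.+1 0 (polar rho phi)).
Proof.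
move=> rho0; elim: k => [|k [IHg IHf]].
  by split; [rewrite g0 | exact: row_free_df0].
have D : g k.+1 (polar rho phi) - pullback (Phi N k.+1 0 (polar rho phi)) =
    (4 * ((k.+1 + 2)%:R * rho ^+ (2 * (k.+1 + 1)))) *: delta_mx 0 0 +
    (4 * ((k.+1 + 1)%:R * rho ^+ (2 * (k.+1 + 1)))) *: delta_mx 1 1.
  by rewrite IHg gS addrAC subrr add0r (polarE rho phi).1.
(* [Phi N k.+2 0] computes to [Phi N k.+1 3], which is three steps applied to [Phi N k.+1 0]. *)
apply: (three_steps_gram k.+1 (Phi N k.+1 0) _ IHf); rewrite D.
  by rewrite !mxE.
by move=> i; apply: H_increment_ge0; rewrite exprn_ge0// ltW.
Qed.

Lemma step_rotation k i F p q Q : rotation Q -> F q = F p *m Q -> g k q = g k p ->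
  cos (2 * pi * (N k i)%:R * varpi i q) = cos (2 * pi * (N k i)%:R * varpi i p) ->
  step N k i F q = step N k i F p *m Q.
Proof.
move=> rQ FE gE cosE.
have etaE : H i (g k q - pullback (F q)) = H i (g k p - pullback (F p)).
  by rewrite gE FE pullback_rotation.
have lamE : dform (@varpi R i) q = dform (@varpi R i) p by rewrite !dform_varpi.
exact: FCP_rotation rQ FE etaE lamE cosE.
Qed.

(** Induction on the stage, and inside a stage on the step; the third step of a stage is the initial
    field of the next. *)
Lemma Phi_rotation l p q Q : rotation Q -> Phi N l.+1 0 q = Phi N l.+1 0 p *m Q ->
  (forall k, g k q = g k p) ->
  (forall k i, (l < k)%N -> (1 <= i <= 3)%N ->
    cos (2 * pi * (N k i)%:R * varpi i q) = cos (2 * pi * (N k i)%:R * varpi i p)) ->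
  forall m i, (i <= 3)%N -> Phi N (l + m).+1 i q = Phi N (l + m).+1 i p *m Q.
Proof.
move=> rQ E0 gE cosE.
have steps m : Phi N (l + m).+1 0 q = Phi N (l + m).+1 0 p *m Q ->
    forall i, (i <= 3)%N -> Phi N (l + m).+1 i q = Phi N (l + m).+1 i p *m Q.
  move=> Em; elim=> [//|i IHi] i3.
  apply: (step_rotation (l + m).+1 i.+1 (Phi N (l + m).+1 i)) => //.
    by apply: IHi; exact: ltnW.
  by apply: cosE; rewrite ?ltnS ?leq_addr.
elim=> [|m IHm]; first by apply: steps; rewrite addn0.
by apply: steps; rewrite addnS; exact: (IHm 3%N).
Qed.

Lemma Phi_inf_rotation l p q Q : rotation Q -> Phi N l.+1 0 q = Phi N l.+1 0 p *m Q ->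
  (forall k, g k q = g k p) ->
  (forall k i, (l < k)%N -> (1 <= i <= 3)%N ->
    cos (2 * pi * (N k i)%:R * varpi i q) = cos (2 * pi * (N k i)%:R * varpi i p)) ->
  Phi_inf N q = Phi_inf N p *m Q.
Proof.
move=> rQ E0 gE cosE; apply: lim_mulmxr.
  by rewrite unitmxE; case: rQ => _ ->; exact: unitr1.
(* Term n of the sequence belongs to stage n / 3 + 1, so from 3 l on all stages exceed l. *)
exists (3 * l)%N => // n /= ln.
have ln3 : (l <= n %/ 3)%N by rewrite leq_divRL// mulnC.
rewrite -(subnKC ln3); apply: Phi_rotation => //.
exact: ltnW (ltn_pmod _ _).
Qed.

End FormalAnalogue.

(** * Hausdorff distance, operator norm and Lipschitz estimates *)

Section Metric.
Context {R : realType} {n : nat}.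
Implicit Types (A B : set 'rV[R]_n) (M : 'M[R]_n) (u : 'rV[R]_n).

Lemma enorm_normalize_le1 u : enorm (normalize u) <= 1.
Proof.
have [->|u0] := eqVneq u 0; first by rewrite /normalize scaler0 enorm0.
by rewrite /enorm dot_normalize// sqrtr1.
Qed.

Lemma hausdorff_dist_le A B (D : \bar R) :
  (forall x, A x -> exists2 y, B y & ((enorm (x - y))%:E <= D)%E) ->
  (forall y, B y -> exists2 x, A x & ((enorm (x - y))%:E <= D)%E) ->
  (hausdorff_dist A B <= D)%E.
Proof.
move=> AB BA; rewrite /hausdorff_dist ge_max; apply/andP; split.
  apply: ge_ereal_sup => _ [x Ax <-]; have [y By xy] := AB x Ax.
  by apply: le_trans xy; apply: ereal_inf_lbound; exists y.
apply: ge_ereal_sup => _ [y By <-]; have [x Ax xy] := BA y By.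
by apply: le_trans xy; apply: ereal_inf_lbound; exists x.
Qed.

Lemma le_opnorm_subr M M' u : M *m M^T = 1%:M -> M' *m M'^T = 1%:M ->
  enorm u <= 1 -> enorm (u *m (M - M')) <= opnorm (M - M').
Proof.
move=> oM oM' u1; apply: sup_ubound; last by exists u.
(* The real supremum bounds its set only if that set is bounded; a difference of two isometries has
   norm at most 2. *)
exists 2 => _ [x /= x1 <-]; rewrite mulmxBr (le_trans (ler_enormD _ _))//.
by rewrite enormN !enorm_orthogonal// (_ : 2 = 1 + 1)// lerD.
Qed.

Lemma invmx_orthogonal M : M *m M^T = 1%:M -> invmx M = M^T.
Proof. by move=> oM; have [uM _] := mulmx1_unit oM; rewrite -[LHS]mulmx1 -oM mulKmx. Qed.

(** Inverses being transposes, the difference is u M1^T (M3 - M2) + u M1^T (M0 - M1) M0^T M2, and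
    the last factor M0^T M2 is an isometry. *)
Lemma enorm_transport_le u M0 M1 M2 M3 : M0 *m M0^T = 1%:M -> M1 *m M1^T = 1%:M ->
  M2 *m M2^T = 1%:M ->
  enorm (u *m (invmx M1 *m M3) - u *m (invmx M0 *m M2)) <=
  enorm (u *m M1^T *m (M3 - M2)) + enorm (u *m M1^T *m (M0 - M1)).
Proof.
move=> o0 o1 o2.
have oQ : (M0^T *m M2) *m (M0^T *m M2)^T = 1%:M.
  by rewrite trmx_mul trmxK -mulmxA (mulmxA M2) o2 mul1mx mulmx1C.
rewrite -[X in _ <= _ + X](enorm_orthogonal _ _ oQ) !invmx_orthogonal//.
apply: le_trans (ler_enormD _ _); rewrite le_eqVlt; apply/orP; left.
apply/eqP; congr enorm; rewrite !mulmxBr mulmxBl -!mulmxA.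
rewrite (mulmxA M0) o0 mul1mx (mulmxA M1^T) (mulmx1C o1) mul1mx.
by rewrite addrA subrK.
Qed.

Variables (F : R -> 'M[R]_n) (F_orthogonal : forall x, F x *m (F x)^T = 1%:M).

Lemma lipschitz_const_ge0 : (0 <= lipschitz_const F)%E.
Proof.
(* A single difference quotient, here at the points 1 and 0, bounds the extended supremum from
   below. *)
apply: (@le_trans _ _ (opnorm (F 1 - F 0) / `|1 - 0|)%:E).
  rewrite lee_fin mulr_ge0// (le_trans _ (le_opnorm_subr _ _ 0 _ _ _))//.
    by rewrite mul0mx enorm0.
  by rewrite enorm0.
by apply: ereal_sup_ubound; exists (1, 0) => //=; exact: oner_neq0.
Qed.

Lemma lipschitz_const_bound u (x y : R) : enorm u <= 1 ->
  ((enorm (u *m (F x - F y)))%:E <= `|x - y|%:E * lipschitz_const F)%E.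
Proof.
(* Equal points give no difference quotient; there both sides vanish, with the convention 0 * oo =
   0. *)
move=> u1; have [->|xy] := eqVneq x y.
  by rewrite !subrr mulmx0 enorm0 normr0 mul0e.
have d0 : 0 < `|x - y| by rewrite normr_gt0 subr_eq0.
apply: (@le_trans _ _ (`|x - y|%:E * (opnorm (F x - F y) / `|x - y|)%:E)%E).
  by rewrite -EFinM lee_fin mulrC divfK ?gt_eqF// le_opnorm_subr.
by apply: lee_wpmul2l; [rewrite lee_fin | apply: ereal_sup_ubound; exists (x, y)].
Qed.

End Metric.

(** * The divisor Omega and the periodicity of the corrugation phases *)

Section Arithmetic.

(** Positivity of [N l 2] puts 1 in the range of the maximum; as 1 divides everything, the maximum
    is attained and is at least 1. *)
Lemma Omega_spec (N : nat -> nat -> nat) l : (0 < N l 2)%N -> (0 < Omega N l)%N /\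
  forall k, (l <= k)%N -> (Omega N l %| N k 2)%N /\ (Omega N l %| N k 3)%N.
Proof.
move=> Nl; pose P (d : 'I_(N l 2).+1) :=
  `[< forall k, (l <= k)%N -> (d %| N k 2)%N /\ (d %| N k 3)%N >].
have P1 : P (inord 1) by apply/asboolP => k _; rewrite inordK// !dvd1n.
have [|d Pd dE] := @eq_bigmax_cond _ P (fun d => val d).
  by apply/card_gt0P; exists (inord 1).
have OE : Omega N l = d by rewrite -dE.
split; last by rewrite OE; move/asboolP: Pd.
have := @leq_bigmax_cond _ P (fun d => val d) _ P1.
by rewrite /= inordK.
Qed.

Context {R : realType}.

Lemma cosD2pin (x : R) (k : nat) : cos (x + 2 * pi * k%:R) = cos x.
Proof. by rewrite -[RHS](periodicn (@cosD2pi R) k) -[pi *+ 2]mulr_natl mulr_natr. Qed.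

Lemma sinD2pin (x : R) (k : nat) : sin (x + 2 * pi * k%:R) = sin x.
Proof. by rewrite -[RHS](periodicn (@sinD2pi R) k) -[pi *+ 2]mulr_natl mulr_natr. Qed.

Lemma df0_periodic (rho phi : R) (k : nat) :
  df0 (polar rho (phi + 2 * pi * k%:R)) = df0 (polar rho phi).
Proof.
have [e0 e1] := df0_polar rho (phi + 2 * pi * k%:R).
rewrite cosD2pin sinD2pin in e0; rewrite cosD2pin sinD2pin in e1.
apply/row_matrixP; apply: ord2P.
  exact: etrans e0 (esym (df0_polar rho phi).1).
exact: etrans e1 (esym (df0_polar rho phi).2).
Qed.

(** The shift s changes [varpi i] by a s up to sign, hence the argument of the outer cosine by 2 pi
    k up to sign, the minus sign occurring for i = 2. *)
Lemma cos_varpi (M i : nat) (rho phi s : R) (k : nat) :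
  (i != 1)%N -> a_const R * s * M%:R = k%:R ->
  cos (2 * pi * M%:R * varpi i (polar rho (phi + s))) =
  cos (2 * pi * M%:R * varpi i (polar rho phi)).
Proof.
move=> i1 sk; have per (x y : R) : x = y + 2 * pi * k%:R -> cos x = cos y.
  by move=> ->; exact: cosD2pin.
have [[r1 p1] [r2 p2]] := (polarE rho (phi + s), polarE rho phi).
case: i i1 => [|[|[|i]]] // _; rewrite /varpi r1 p1 r2 p2.
- by apply: per; rewrite -sk; ring.
- by apply/esym; apply: per; rewrite -sk; ring.
- by apply: per; rewrite -sk; ring.
Qed.

Lemma cos_varpi1 (M : nat) (rho phi phi' : R) :
  cos (2 * pi * M%:R * varpi 1 (polar rho phi')) =
  cos (2 * pi * M%:R * varpi 1 (polar rho phi)).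
Proof. by rewrite /varpi (polarE rho phi).1 (polarE rho phi').1. Qed.

Lemma angleS N l j : angle R N l j.+1 = angle R N l j + angle R N l 1.
Proof. by rewrite /angle -natr1; ring. Qed.

Lemma angle0 N l : angle R N l 0 = 0.
Proof. by rewrite /angle mulr0 !mul0r. Qed.

(** The factor 7 / (2 pi) of a cancels against the angle 2 j pi / (7 Omega), leaving j M / Omega. *)
Lemma a_const_angle N l j M : (Omega N l %| M)%N -> (0 < Omega N l)%N ->
  a_const R * angle R N l j * M%:R = (j * (M %/ Omega N l))%:R.
Proof.
move=> /divnK <- O0; rewrite mulnK// /a_const /angle !natrM.
have pi0 : (pi : R) != 0 by rewrite gt_eqF// pi_gt0.
have OR : (Omega N l)%:R != 0 :> R by rewrite pnatr_eq0 -lt0n.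
by move: (pi) pi0 => P P0; field; rewrite P0 OR.
Qed.

End Arithmetic.

(** * Transport of the limit normal from one sector to another *)

Section Normal.
Context {R : realType}.
Variable N : nat -> nat -> nat.
Implicit Types (p q : 'rV[R]_2) (Q : 'M[R]_3).

Lemma n_inf_rotation l p q Q : rotation Q -> Phi N l.+1 0 q = Phi N l.+1 0 p *m Q ->
  (forall k, g k q = g k p) ->
  (forall k i, (l < k)%N -> (1 <= i <= 3)%N ->
    cos (2 * pi * (N k i)%:R * varpi i q) = cos (2 * pi * (N k i)%:R * varpi i p)) ->
  n_inf N q = n_inf N p *m Q.
Proof.
move=> rQ E0 gE cosE; rewrite /n_inf (Phi_inf_rotation N l p q Q rQ E0 gE cosE).
have lamE x : ell1 x = varpi_form 1 by exact: dform_varpi.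
by rewrite !lamE; exact: frame_n_rotation.
Qed.

(** The special case l = 0 disappears, because Phi_{1,0} is df_0 and Phi_{l+1,0} is Phi_{l,3}. *)
Lemma FframeE l p : Fframe N l p = frame (Phi N l.+1 0 p) (varpi_form 1).
Proof.
have lamE : ell1 p = varpi_form 1 by exact: dform_varpi.
by rewrite /Fframe lamE; case: l.
Qed.

Lemma Fframe_rotation l (rho phi : R) : 0 < rho -> rotation (Fframe N l (polar rho phi)).
Proof.
move=> rho0; rewrite FframeE; apply: frame_is_rotation; first exact: varpi_form_neq0.
by have [] := Phi_gram N l rho phi rho0.
Qed.

Lemma Fframe_unit l (rho phi : R) : 0 < rho -> Fframe N l (polar rho phi) \in unitmx.
Proof. by move=> rho0; have [/mulmx1_unit[]] := Fframe_rotation l rho phi rho0. Qed.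

(** Equal Gram matrices provide some rotation Q between the two values of Phi_{l+1,0}; since frames
    follow Q, it is the quotient of the two frames. The phases with i = 1 depend on rho only, so
    integrality is asked for i = 2, 3. *)
Lemma n_inf_shift l (rho phi s : R) : 0 < rho ->
  (forall k i, (l < k)%N -> (1 < i <= 3)%N ->
    exists m : nat, a_const R * s * (N k i)%:R = m%:R) ->
  n_inf N (polar rho (phi + s)) = n_inf N (polar rho phi) *m
    (invmx (Fframe N l (polar rho phi)) *m Fframe N l (polar rho (phi + s))).
Proof.
move=> rho0 sN; have [Gp fp] := Phi_gram N l rho phi rho0.
have [Gq fq] := Phi_gram N l rho (phi + s) rho0.
have [| |Q rQ QE] := gram_rotation
    (Phi N l.+1 0 (polar rho phi)) (Phi N l.+1 0 (polar rho (phi + s))).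
- by rewrite Gp Gq; exact: g_polar.
- apply: cross_neq0 => a b ab0; have /eqP : polar a b *m Phi N l.+1 0 (polar rho phi) = 0.
    by rewrite row2E (polarE a b).1 (polarE a b).2.
  rewrite mulmx_free_eq0// => /eqP/rowP ab.
  by have := ab 0; have := ab 1; rewrite (polarE a b).1 (polarE a b).2 !mxE.
have FQ : Fframe N l (polar rho (phi + s)) = Fframe N l (polar rho phi) *m Q.
  by rewrite !FframeE QE; exact: frame_rotation.
rewrite FQ mulKmx ?Fframe_unit//.
apply: (n_inf_rotation l _ _ Q rQ QE); first by move=> k; exact: g_polar.
move=> k [|[|i]] //; first by move=> _ _; exact: cos_varpi1.
move=> lk i3; have [m mE] := sN k i.+2 lk i3.
exact: cos_varpi mE.
Qed.

(** Transport by the identity from the 2 pi-periodic df_0: the shift multiplies with a and the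
    corrugation number to the integer 7 m N_{k,i}. *)
Lemma n_inf_periodic (rho phi : R) (m : nat) : 0 < rho ->
  n_inf N (polar rho (phi + 2 * pi * m%:R)) = n_inf N (polar rho phi).
Proof.
move=> rho0; rewrite -[RHS]mulmx1.
have r1 : rotation (1%:M : 'M[R]_3) by split; rewrite ?trmx1 ?mulmx1 ?det1.
have E0 : Phi N 1 0 (polar rho (phi + 2 * pi * m%:R)) =
    Phi N 1 0 (polar rho phi) *m 1%:M by rewrite mulmx1; exact: df0_periodic.
apply: (n_inf_rotation 0 _ _ _ r1 E0); first by move=> k; exact: g_polar.
move=> k [|[|i]] // _ _; first exact: cos_varpi1.
apply: (cos_varpi _ _ _ _ _ (7 * m * N k i.+2)) => //.
rewrite /a_const !natrM; have : (pi : R) != 0 by rewrite gt_eqF// pi_gt0.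
by move: (pi) => P P0; field.
Qed.

Section Sector.
Variables (rho : R) (l : nat).
Hypotheses (rho0 : 0 < rho) (Nl : (0 < N l.+1 2)%N).
Notation Om := (Omega N l.+1).
Notation F := (fun phi => Fframe N l (polar rho phi)).

Lemma n_inf_sector (phi : R) (j : nat) :
  n_inf N (polar rho (phi + angle R N l.+1 j)) = n_inf N (polar rho phi) *m
    (invmx (F phi) *m F (phi + angle R N l.+1 j)).
Proof.
have [gt0O OP] := Omega_spec N l.+1 Nl.
apply: n_inf_shift => // k i lk i3; have [d2 d3] := OP k lk.
have dO : (Om %| N k i)%N by case: i i3 => [|[|[|[|i]]]].
by exists (j * (N k i %/ Om))%N; exact: a_const_angle.
Qed.

Lemma sector_estimate (phi : R) (j : nat) : 0 <= phi <= angle R N l.+1 1 ->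
  ((enorm (n_inf N (polar rho (phi + angle R N l.+1 j)) -
           rot_sector N rho l.+1 j (n_inf N (polar rho phi))))%:E <=
   (4 * pi / (7 * Om)%:R)%:E * Lip N rho l)%E.
Proof.
move=> /andP[phi0 phi1]; rewrite n_inf_sector /rot_sector /rot_mx /=.
set s := angle R N l.+1 j; set c := n_inf N (polar rho phi).
have oF x : F x *m (F x)^T = 1%:M by have [] := Fframe_rotation l rho x rho0.
(* These are the coordinates of the normal in the frame at phi. *)
have d1 : enorm (c *m (F phi)^T) <= 1.
  rewrite enorm_orthogonal ?enorm_normalize_le1// trmxK; exact: mulmx1C.
have L0 : (0 <= Lip N rho l)%E := lipschitz_const_ge0 F oF.
have b1 : ((enorm (c *m (F phi)^T *m (F (phi + s) - F s)))%:E <= phi%:E * Lip N rho l)%E.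
  have := lipschitz_const_bound F oF _ (phi + s) s d1.
  by rewrite addrK ger0_norm.
have b2 : ((enorm (c *m (F phi)^T *m (F 0 - F phi)))%:E <= phi%:E * Lip N rho l)%E.
  have := lipschitz_const_bound F oF _ 0 phi d1.
  by rewrite sub0r normrN ger0_norm.
(* Each of the two frame differences is taken at distance phi, at most 2 pi / (7 Omega), whence the
   constant 4 pi. *)
apply: (@le_trans _ _ ((phi + phi)%:E * Lip N rho l)%E).
  rewrite EFinD ge0_muleDl ?lee_fin//; apply: le_trans (leeD b1 b2).
  by rewrite -EFinD lee_fin; exact: enorm_transport_le.
apply: lee_wpmul2r => //; rewrite lee_fin.
rewrite (_ : 4 * pi / _ = angle R N l.+1 1 + angle R N l.+1 1) ?lerD//.
by rewrite /angle; ring.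
Qed.

(** The 7 Omega sectors tile one full turn, and the normal is 2 pi-periodic. *)
Lemma n_inf_circle (phi : R) : exists j phi', [/\ (j < 7 * Om)%N,
  0 <= phi' <= angle R N l.+1 1 &
  n_inf N (polar rho phi) = n_inf N (polar rho (phi' + angle R N l.+1 j))].
Proof.
have [gt0O _] := Omega_spec N l.+1 Nl.
have pi0 := @pi_gt0 R.
wlog phi0 : phi / 0 <= phi.
  (* Adding m + 1 > |phi| full turns makes the angle nonnegative. *)
  move=> wl; pose m := Num.truncn `|phi|.
  have [|j [phi' [j1 p1 E]]] := wl (phi + 2 * pi * m.+1%:R).
    have := truncnS_gt `|phi|; have := ler_norm (- phi); rewrite normrN.
    have := @pi_ge2 R; rewrite -/m; set M := m.+1%:R => pi2 h1 h2.
    have : 0 <= M by rewrite /M. nra.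
  by exists j, phi'; split=> //; rewrite -E n_inf_periodic.
pose del := angle R N l.+1 1.
have del0 : 0 < del.
  by rewrite /del /angle !mulr_gt0// ?invr_gt0 ltr0n ?muln_gt0.
pose J := Num.truncn (phi / del).
have /andP[J1 J2] : J%:R <= phi / del < J.+1%:R by apply: truncn_itv; rewrite divr_ge0// ltW.
have angleE k : angle R N l.+1 k = k%:R * del by rewrite /del /angle; ring.
(* J numbers the sector on the real line; its quotient by 7 Omega counts whole turns, removed by
   periodicity, and its remainder is the index j. *)
exists (J %% (7 * Om))%N, (phi - J%:R * del); split.
- by rewrite ltn_mod muln_gt0.
- move: J1 J2; rewrite ler_pdivlMr// ltr_pdivrMr// -natr1 -/del; lra.
rewrite -[RHS](n_inf_periodic _ _ (J %/ (7 * Om)))//; congr (n_inf N (polar rho _)).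
have full : 2 * pi = (7 * Om)%:R * del.
  rewrite /del /angle; have : (7 * Om)%:R != 0 :> R by rewrite pnatr_eq0 -lt0n muln_gt0.
  by move: (7 * Om)%:R (pi) => w P w0; field.
have JE : J%:R = (J %/ (7 * Om))%:R * (7 * Om)%:R + (J %% (7 * Om))%:R :> R.
  by rewrite -natrM -natrD -divn_eq.
by rewrite full angleE JE; ring.
Qed.

End Sector.
End Normal.

(** * Hausdorff estimates on one sector and on the whole circle *)

Theorem proposition6 (R : realType) (N : nat -> nat -> nat)
  (N_gt0 : forall k i : nat, (1 <= k)%N -> (1 <= i <= 3)%N -> (0 < N k i)%N)
  (rho : R) (rho01 : 0 < rho < 1) (l : nat) (l_ge1 : (1 <= l)%N) :
  (forall j : nat, (j < 7 * Omega N l)%N ->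
    (hausdorff_dist (n_inf N @` Gamma_sector N rho l j)
       (rot_sector N rho l j @` (n_inf N @` Gamma_sector N rho l 0))
     <= (4 * pi / (7 * Omega N l)%:R)%:E * Lip N rho l.-1)%E) /\
  (hausdorff_dist (n_inf N @` Gamma_circle rho)
     (\bigcup_(j < 7 * Omega N l)
        (rot_sector N rho l j @` (n_inf N @` Gamma_sector N rho l 0)))
   <= (4 * pi / (7 * Omega N l)%:R)%:E * Lip N rho l.-1)%E.
Proof.
case: l l_ge1 => // l _; have /andP[rho0 _] := rho01.
have Nl : (0 < N l.+1 2)%N by exact: N_gt0.
have sector0 phi : (0 <= phi <= angle R N l.+1 1) =
    (phi \in `[angle R N l.+1 0, angle R N l.+1 1]).
  by rewrite in_itv /= angle0.
have est phi j phi_in := sector_estimate N rho l rho0 Nl phi j phi_in.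
(* Each normal at phi + [angle R N l.+1 j] is paired with the rotated normal at phi, for phi in
   sector 0, in both directions of the distance. *)
split=> [j _|]; apply: hausdorff_dist_le.
- move=> _ [_ [phi phi_in <-] <-].
  have phi'_in : 0 <= phi - angle R N l.+1 j <= angle R N l.+1 1.
    by move: phi_in; rewrite /= in_itv /= angleS; lra.
  exists (rot_sector N rho l.+1 j (n_inf N (polar rho (phi - angle R N l.+1 j)))).
    exists (n_inf N (polar rho (phi - angle R N l.+1 j))) => //.
    exists (polar rho (phi - angle R N l.+1 j)) => //.
    by exists (phi - angle R N l.+1 j) => //=; rewrite -sector0.
  by have := est _ j phi'_in; rewrite subrK.
- move=> _ [_ [_ [phi phi_in <-] <-] <-].
  have phi0 : 0 <= phi <= angle R N l.+1 1 by rewrite sector0.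
  exists (n_inf N (polar rho (phi + angle R N l.+1 j))); last exact: est.
  exists (polar rho (phi + angle R N l.+1 j)) => //.
  exists (phi + angle R N l.+1 j) => //=.
  by rewrite in_itv /= angleS; lra.
- move=> _ [_ [phi _ <-] <-].
  have [j [phi' [j1 phi'1 ->]]] := n_inf_circle N rho l rho0 Nl phi.
  exists (rot_sector N rho l.+1 j (n_inf N (polar rho phi'))); last exact: est.
  exists j => //; exists (n_inf N (polar rho phi')) => //.
  by exists (polar rho phi') => //; exists phi' => //=; rewrite -sector0.
- move=> _ [j _ [_ [_ [phi phi_in <-] <-] <-]].
  have phi0 : 0 <= phi <= angle R N l.+1 1 by rewrite sector0.
  exists (n_inf N (polar rho (phi + angle R N l.+1 j))); last exact: est.
  by exists (polar rho (phi + angle R N l.+1 j)) => //; exists (phi + angle R N l.+1 j).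
Qed.
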